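(* Let $\mu>0$, $\sigma>0$, $\beta>0$, $\tau>0$, $p\in(0,1)$, $\alpha\in\mathbb{R}$, $\rho\in\mathbb{R}$ with $\rho^2<1$, and let the level $\overline{VaR}$ be a given constant. Put $N=\Phi^{-1}(1-p)/\sqrt{\tau}$ and $M=\alpha+\overline{VaR}/\tau$, where $N>0$ and $M>0$. Then the explicit form of the constraint $VaR_t^{p,f}\le\overline{VaR}$ on the amount $f\in\mathbb{R}$ invested in the stock at time $t$ is $f\in I$ (that is, the constraint is equivalent to $f\in I$), where $$I=\begin{cases}\Big[\dfrac{M^2-N^2\beta^2}{2\mu(\rho\beta N-M)},+\infty\Big), & \text{if } N\sigma=\mu,\ \rho\beta N<M,\\[2mm] [f_1,+\infty), & \text{if } N\sigma<\mu,\\[1mm] [f_2,f_1], & \text{if } 0<N^2\sigma^2-\mu^2\le\dfrac{(\sigma M-\rho\beta\mu)^2}{(1-\rho^2)\beta^2},\ \rho\beta\mu<\sigma M,\\[2mm] \emptyset, & \text{otherwise,}\end{cases}$$ and $$f_{1,2}=\frac{2(\mu M-\rho\sigma\beta N^2)\pm\sqrt{\Delta}}{2(N^2\sigma^2-\mu^2)}$$ if $\Delta=4N^2\big((1-\rho^2)\beta^2(\mu^2-N^2\sigma^2)+(\sigma M-\rho\beta\mu)^2\big)\ge0$ and $N^2\sigma^2\ne\mu^2$, labelled so that $f_1$ is always the larger of the two values (with $f_1=f_2$ when $\Delta=0$).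
   Context: $W^{(1)}$ and $W^{(2)}$ are standard Brownian motions with correlation coefficient $\rho$, on a filtered probability space $(\Omega,\mathcal{F},(\mathcal{F}_t)_{t\ge0},P)$ satisfying the usual conditions. The wealth process is $dX_t=(f_t\mu+\alpha)\,dt+f_t\sigma\,dW_t^{(1)}+\beta\,dW_t^{(2)}$, where $f_t$ is the amount invested in the stock. Value-at-risk: for a strategy with value $f=f_t$ at time $t$, kept constant on $(t,t+\tau]$, put $$\mathcal{X}_{t+\tau}=X_t+(f\mu+\alpha)\tau+f\sigma(W^{(1)}_{t+\tau}-W^{(1)}_t)+\beta(W^{(2)}_{t+\tau}-W^{(2)}_t).$$ For the probability level $p$ and horizon $\tau$, $VaR_t^{p,f}=(Q_t^{p,f})^-$, where $Q_t^{p,f}=\sup\{L\in\mathbb{R}: P(\mathcal{X}_{t+\tau}-X_t\le L\mid\mathcal{F}_t)<p\}$ and $z^-=\max\{0,-z\}$. $\Phi$ denotes the standard normal distribution function and $\Phi^{-1}$ its inverse. The constant $\overline{VaR}$ is the prescribed upper limit that the value-at-risk of the chosen portfolio may not exceed at any time $t\in[0,T]$, where $T$ is the terminal time.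
   Formalization: The level VaRbar is assumed nonnegative; for VaRbar < 0 the constraint never holds because VaR ≥ 0, while I can be nonempty (e.g. VaRbar = -1, alpha = 10, tau = 1, N sigma < mu), so the claim fails there. *)

(* Defs.v *)
From HB Require Import structures.
From mathcomp Require Import all_boot all_order all_algebra.
From mathcomp Require Import all_classical all_reals all_analysis.

Set Implicit Arguments.
Unset Strict Implicit.
Unset Printing Implicit Defensive.
Import Order.TTheory GRing.Theory Num.Theory.
Import numFieldNormedType.Exports.
Local Open Scope classical_set_scope.
Local Open Scope ring_scope.

(* Time is [R]; only times [t >= 0] are ever constrained or used. *)

Definition measurable_wrt (R : realType) (Omega : Type) (G : set (set Omega))
    (g : Omega -> R) : Prop :=
  forall B : set R, measurable B -> G (g @^-1` B).

Section filtered_space.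
Context (R : realType) (d : measure_display) (Omega : measurableType d).
Variable P : probability Omega R.

(* The negligible sets are all subsets of measurable null sets, so that
   [usual_null] contains the completeness of the underlying space. *)
Record usual_filtration (F : R -> set (set Omega)) : Prop := UsualFiltration {
  usual_sigma : forall t : R, 0 <= t -> sigma_algebra setT (F t);
  usual_sub : forall t : R, 0 <= t -> F t `<=` measurable;
  usual_mono : forall s t : R, 0 <= s -> s <= t -> F s `<=` F t;
  usual_null : forall A, P.-negligible A -> F 0 A;
  usual_rcont : forall t : R, 0 <= t -> F t = \bigcap_(u in `]t, +oo[) F u
}.

Definition independent_of (d' : measure_display) (U : measurableType d')
    (G : set (set Omega)) (Y : Omega -> U) : Prop :=
  forall (A : set Omega) (B : set U), G A -> measurable B ->
    (P (A `&` Y @^-1` B) = P A * P (Y @^-1` B))%E.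

Definition has_law (Y : Omega -> R) (nu : set R -> \bar R) : Prop :=
  forall B : set R, measurable B -> P (Y @^-1` B) = nu B.

Definition increment (W : R -> Omega -> R) (s t : R) : Omega -> R :=
  fun w => W t w - W s w.

Record brownian_motion (F : R -> set (set Omega)) (W : R -> Omega -> R) :
    Prop := BrownianMotion {
  bm_adapted : forall t : R, 0 <= t -> measurable_wrt (F t) (W t);
  bm_start : {ae P, forall w, W 0 w = 0};
  bm_continuous : {ae P, forall w,
    {within `[0, +oo[, continuous (fun t : R => W t w)}};
  bm_indep : forall s t : R, 0 <= s -> s < t ->
    independent_of (F s) (increment W s t);
  bm_normal : forall s t : R, 0 <= s -> s < t ->
    has_law (increment W s t) (normal_prob 0 (Num.sqrt (t - s)))
}.

(* [normal_prob m s] is the normal law of mean [m] and standard deviation [s]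
   only for [s != 0]; the degenerate normal law is the Dirac mass at [m]. *)
Definition gaussian_law (m s : R) (B : set R) : \bar R :=
  if s == 0 then \d_m B else normal_prob m s B.

Definition gaussian_vector (U V : Omega -> R) : Prop :=
  forall a b : R, exists m s : R, 0 <= s /\
    has_law (fun w => a * U w + b * V w) (gaussian_law m s).

(* The increments over [s, t] form a Gaussian vector, independent of the past
   as a vector, and each of variance [t - s], so that the covariance
   [rho * (t - s)] says that their correlation coefficient is [rho]. *)
Record correlated_brownian_motions (F : R -> set (set Omega))
    (W1 W2 : R -> Omega -> R) (rho : R) : Prop := CorrelatedBrownianMotions {
  cbm_fst : brownian_motion F W1;
  cbm_snd : brownian_motion F W2;
  cbm_indep : forall s t : R, 0 <= s -> s < t ->
    independent_of (F s) (fun w => (increment W1 s t w, increment W2 s t w));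
  cbm_gaussian : forall s t : R, 0 <= s -> s < t ->
    gaussian_vector (increment W1 s t) (increment W2 s t);
  cbm_cov : forall s t : R, 0 <= s -> s < t ->
    covariance P (increment W1 s t) (increment W2 s t) = (rho * (t - s))%:E
}.

(* [kappa] is a (regular) version of the conditional law P(Y \in . | G): for
   each Borel set [B], [kappa ^~ B] is a version of P(Y \in B | G).  Regularity
   gives a meaning to a supremum over uncountably many levels. *)
Record conditional_law (G : set (set Omega)) (Y : Omega -> R)
    (kappa : Omega -> probability (measurableTypeR R) R) : Prop := ConditionalLaw {
  cl_measurable : forall B : set R, measurable B ->
    measurable_wrt G (fun w => fine (kappa w B));
  cl_integral : forall (A : set Omega) (B : set R), G A -> measurable B ->
    (\int[P]_(w in A) kappa w B = P (A `&` Y @^-1` B))%E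
}.

End filtered_space.

Section value_at_risk.
Context (R : realType) (Omega : Type).

(* Wealth at [t + tau] when the amount invested in the stock is held constant,
   equal to [f t], on (t, t + tau]. *)
Definition frozen_wealth (mu sigma alpha beta : R)
    (W1 W2 X f : R -> Omega -> R) (t tau : R) : Omega -> R :=
  fun w => X t w + (f t w * mu + alpha) * tau
    + f t w * sigma * (W1 (t + tau) w - W1 t w)
    + beta * (W2 (t + tau) w - W2 t w).

Definition wealth_change (mu sigma alpha beta : R)
    (W1 W2 X f : R -> Omega -> R) (t tau : R) : Omega -> R :=
  fun w => frozen_wealth mu sigma alpha beta W1 W2 X f t tau w - X t w.

Definition neg_part (z : R) : R := Num.max 0 (- z).

Definition cond_quantile (kappa : Omega -> probability (measurableTypeR R) R) (p : R) :
    Omega -> R :=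
  fun w => sup [set L : R | (kappa w [set` `]-oo, L]] < p%:E)%E].

Definition value_at_risk (kappa : Omega -> probability (measurableTypeR R) R) (p : R) :
    Omega -> R :=
  fun w => neg_part (cond_quantile kappa p w).

End value_at_risk.

Section constraint_set.
Context {R : realType}.

Definition Phi (x : R) : R := fine (normal_prob 0 1 `]-oo, x]).

Definition Phi_inv : R -> R := pinv_ (fun=> 0) setT Phi.

Variables mu sigma beta rho N M : R.

Definition Delta : R :=
  4 * N ^+ 2 * ((1 - rho ^+ 2) * beta ^+ 2 * (mu ^+ 2 - N ^+ 2 * sigma ^+ 2)
                + (sigma * M - rho * beta * mu) ^+ 2).

Definition f_plus : R :=
  (2 * (mu * M - rho * sigma * beta * N ^+ 2) + Num.sqrt Delta)
    / (2 * (N ^+ 2 * sigma ^+ 2 - mu ^+ 2)).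

Definition f_minus : R :=
  (2 * (mu * M - rho * sigma * beta * N ^+ 2) - Num.sqrt Delta)
    / (2 * (N ^+ 2 * sigma ^+ 2 - mu ^+ 2)).

(* The sign of the denominator decides which root is the larger one. *)
Definition f1 : R := Num.max f_plus f_minus.
Definition f2 : R := Num.min f_plus f_minus.

Definition VaR_interval : set R :=
  if (N * sigma == mu) && (rho * beta * N < M) then
    [set` `[(M ^+ 2 - N ^+ 2 * beta ^+ 2)
              / (2 * mu * (rho * beta * N - M)), +oo[]
  else if N * sigma < mu then [set` `[f1, +oo[]
  else if [&& 0 < N ^+ 2 * sigma ^+ 2 - mu ^+ 2,
              N ^+ 2 * sigma ^+ 2 - mu ^+ 2
                <= (sigma * M - rho * beta * mu) ^+ 2
                   / ((1 - rho ^+ 2) * beta ^+ 2)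
            & rho * beta * mu < sigma * M] then [set` `[f2, f1]]
  else set0.

End constraint_set.

(* Main.v *)
Require Import Defs.
From HB Require Import structures.
From mathcomp Require Import all_boot all_order all_algebra.
From mathcomp Require Import all_classical all_reals all_analysis.
From mathcomp Require Import measurable_realfun ring lra.

Import Order.TTheory GRing.Theory Num.Theory.
Import numFieldNormedType.Exports.
Local Open Scope classical_set_scope.
Local Open Scope ring_scope.

(** Given [F t], the amount [x] invested at time [t] is a constant and the
    increments of the Brownian motions are an independent Gaussian vector, so the
    wealth change is normal of mean [(x mu + alpha) tau] and variance [tau g(x)],
    where [g(x) = sigma^2 x^2 + 2 rho sigma beta x + beta^2 > 0].  The constraint
    on the value-at-risk hence reads [N sqrt(g(x)) <= M + mu x], that is,
    [N^2 g(x) <= (M + mu x)^2] together with [0 <= M + mu x].  The quadratic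
    inequality excludes the point [- M / mu], and the position of that point
    relative to the roots decides which part of the solution set survives. *)

Set Implicit Arguments.
Unset Strict Implicit.
Unset Printing Implicit Defensive.

(** * The quadratic constraint *)

Lemma le_sqrt_mul_iff (R : realType) (N g c : R) : 0 < N -> 0 <= g ->
  (N * Num.sqrt g <= c) <-> (0 <= c /\ N ^+ 2 * g <= c ^+ 2).
Proof.
move=> N0 g0.
have NS : 0 <= N * Num.sqrt g by rewrite mulr_ge0 ?sqrtr_ge0// ltW.
split=> [h|[c0 h]].
  have c0 := le_trans NS h; split=> //.
  have := h; rewrite -(ler_pXn2r (n:=2))// ?nnegrE//.
  by rewrite exprMn sqr_sqrtr.
rewrite -(ler_pXn2r (n:=2))// ?nnegrE//.
by rewrite exprMn sqr_sqrtr.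
Qed.

Lemma ltr_norm_sqr (R : realDomainType) (x s : R) : 0 <= s ->
  (`|x| < s) = (x ^+ 2 < s ^+ 2).
Proof. by move=> s0; rewrite -(ltr_pXn2r (n:=2)) ?nnegrE// real_normK ?num_real. Qed.

Lemma ler_norm_sqr (R : realDomainType) (x s : R) : 0 <= s ->
  (`|x| <= s) = (x ^+ 2 <= s ^+ 2).
Proof. by move=> s0; rewrite -(ler_pXn2r (n:=2)) ?nnegrE// real_normK ?num_real. Qed.

(** With [a y^2 - 2 b y + c <= 0] as the quadratic inequality and [y0 = - M / mu], the sign of [a]
    is that of [N sigma - mu]. For [a = 0] the inequality is linear. For [a < 0] its solutions lie
    outside the two roots, for [a > 0] between them, and [y0 <= x] cuts this set at a point that is
    never a solution. *)
Lemma VaR_intervalP (R : realType) (mu sigma beta rho N M x : R) :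
  0 < mu -> 0 < sigma -> 0 < beta -> rho ^+ 2 < 1 -> 0 < N -> 0 < M ->
  N * Num.sqrt (sigma ^+ 2 * x ^+ 2 + 2 * rho * sigma * beta * x + beta ^+ 2)
    <= M + x * mu <-> VaR_interval mu sigma beta rho N M x.
Proof.
move=> mu0 s0 b0 r1 N0 M0.
set g := (X in Num.sqrt X).
have g0 y : 0 < sigma ^+ 2 * y ^+ 2 + 2 * rho * sigma * beta * y + beta ^+ 2.
  have -> : sigma ^+ 2 * y ^+ 2 + 2 * rho * sigma * beta * y + beta ^+ 2 =
     (sigma * y + rho * beta) ^+ 2 + (1 - rho ^+ 2) * beta ^+ 2 by ring.
  by rewrite ltr_wpDl ?sqr_ge0// mulr_gt0 ?subr_gt0// exprn_gt0.
rewrite le_sqrt_mul_iff//; last exact/ltW/g0.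
set a := N ^+ 2 * sigma ^+ 2 - mu ^+ 2.
set b := mu * M - rho * sigma * beta * N ^+ 2.
pose c := N ^+ 2 * beta ^+ 2 - M ^+ 2.
have E y : N ^+ 2 * (sigma ^+ 2 * y ^+ 2 + 2 * rho * sigma * beta * y
     + beta ^+ 2) - (M + y * mu) ^+ 2 = a * y ^+ 2 - 2 * b * y + c.
  by rewrite /a /b /c; ring.
have {}E : (N ^+ 2 * g <= (M + x * mu) ^+ 2) <-> a * x ^+ 2 - 2 * b * x + c <= 0.
  by rewrite -E subr_le0.
rewrite E => {E}.
have DE : Delta mu sigma beta rho N M = 4 * (b ^+ 2 - a * c).
  by rewrite /Delta /a /b /c; ring.
have key y : a * y ^+ 2 - 2 * b * y + c <= 0 -> M + y * mu != 0.
  move=> h; apply/eqP => h2; move: h; rewrite leNgt => /negP; apply.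
  have -> : a * y ^+ 2 - 2 * b * y + c = N ^+ 2 * (sigma ^+ 2 * y ^+ 2 +
   2 * rho * sigma * beta * y + beta ^+ 2) - (M + y * mu) ^+ 2.
    by rewrite /a /b /c; ring.
  by rewrite h2 expr0n subr0 mulr_gt0 ?exprn_gt0.
have [y0 y0E] : exists y, M + y * mu = 0.
  by exists (- M / mu); rewrite mulrVK ?unitfE ?gt_eqF// subrr.
have q0 : 0 < a * y0 ^+ 2 - 2 * b * y0 + c.
  by rewrite ltNge; apply/negP => /key; rewrite y0E eqxx.
have posE : (0 <= M + x * mu) = (y0 <= x).
  by rewrite -y0E lerD2l ler_pM2r.
rewrite posE.
(* Because [mu * y0 = - M], the left side is [- mu * (a * y0 - b)]; its sign therefore tells on
   which side of the vertex [b / a] the point [y0] lies when [a > 0]. *)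
have aE : a * M + b * mu = N ^+ 2 * sigma * (sigma * M - rho * beta * mu).
  by rewrite /a /b; ring.
have N2 : 0 < N ^+ 2 by rewrite exprn_gt0.
have R0 : 0 < (1 - rho ^+ 2) * beta ^+ 2 by rewrite mulr_gt0 ?subr_gt0 ?exprn_gt0.
have sqa : (a == 0) = (N * sigma == mu).
  by rewrite /a -exprMn subr_eq0 eqrXn2 ?mulr_ge0 ?ltW.
have lta : (a < 0) = (N * sigma < mu).
  by rewrite /a -exprMn subr_lt0 ltr_pXn2r ?nnegrE ?mulr_ge0 ?ltW.
rewrite /VaR_interval -/a -sqa -lta.
have [a0|an0] := eqVneq a 0.
  have Nsm : N * sigma = mu by apply/eqP; rewrite -sqa a0.
  have bE : b = mu * (M - rho * beta * N) by rewrite /b -Nsm; ring.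
  (* For [a = 0] this is [mu] times the value of the quadratic at [y0]. It places [y0] below the
     threshold [c / (2 b)] when [b > 0]. *)
  have pos : 0 < 2 * b * M + mu * c.
    have -> : 2 * b * M + mu * c =
       mu * ((M - rho * beta * N) ^+ 2 + N ^+ 2 * ((1 - rho ^+ 2) * beta ^+ 2)).
      by rewrite bE /c; ring.
    by rewrite mulr_gt0// ltr_wpDl ?sqr_ge0// mulr_gt0.
  rewrite a0 mul0r sub0r ltxx.
  have [h|h] /= := ltP (rho * beta * N) M.
    have b0' : 0 < b by rewrite bE mulr_gt0// subr_gt0.
    rewrite in_itv/= andbT.
    have -> : (M ^+ 2 - N ^+ 2 * beta ^+ 2) / (2 * mu * (rho * beta * N - M)) =
       c / (2 * b).
      have h' : rho * beta * N - M != 0 by rewrite subr_eq0 lt_eqF.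
      have h2 : M - rho * beta * N != 0 by rewrite subr_eq0 gt_eqF.
      by rewrite bE /c; field; rewrite ?h' ?h2 ?gt_eqF.
    rewrite ler_pdivrMr ?mulr_gt0//.
    split=> [[_ hx]|hx]; first by lra.
    split; last by lra.
    rewrite -posE -(pmulr_rge0 (x:=2 * b))?mulr_gt0//.
    have : mu * c <= mu * (x * (2 * b)) by rewrite ler_pM2l.
    by lra.
  (* Here [b <= 0] and the interval is empty: the linear inequality and [0 <= M + x * mu] together
     contradict [pos]. *)
  split=> // -[]; rewrite -posE => h1 h2.
  have b0N : 0 <= - b by rewrite bE; nra.
  have : mu * c <= mu * (x * (2 * b)) by rewrite ler_pM2l//; lra.
  have : 0 <= (- b) * (M + x * mu) by rewrite mulr_ge0.
  by lra.
(* A quarter of [Delta]. After completing the square in [qE], each comparison of a point [y] with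
   the roots becomes one of [a * y - b] with [s] and [- s]. *)
pose D := b ^+ 2 - a * c.
pose s := Num.sqrt D.
have qE y : a * (a * y ^+ 2 - 2 * b * y + c) = (a * y - b) ^+ 2 - D.
  by rewrite /D; ring.
have sD : Num.sqrt (Delta mu sigma beta rho N M) = 2 * s.
  rewrite DE (_ : 4 * _ = 2 ^+ 2 * D); last by rewrite /D; ring.
  by rewrite sqrtrM ?sqr_ge0// sqrtr_sqr ger0_norm.
have fpE : f_plus mu sigma beta rho N M = (b + s) / a.
  by rewrite /f_plus sD -/a -/b; field.
have fmE : f_minus mu sigma beta rho N M = (b - s) / a.
  by rewrite /f_minus sD -/a -/b; field.
have s0' : 0 <= s by rewrite sqrtr_ge0.
have D4 : D = N ^+ 2 * ((sigma * M - rho * beta * mu) ^+ 2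
    - a * ((1 - rho ^+ 2) * beta ^+ 2)).
  by rewrite /D /a /b /c; ring.
move: an0; rewrite neq_lt => /orP[an|ap].
  rewrite an /= in_itv/= andbT /f1 fpE fmE.
  have D0 : 0 < D.
    by rewrite D4 mulr_gt0// ltr_wpDl ?sqr_ge0// oppr_gt0 pmulr_llt0.
  have s2 : s ^+ 2 = D by rewrite sqr_sqrtr ?ltW.
  have -> : Num.max ((b + s) / a) ((b - s) / a) = (b - s) / a.
    by apply/max_idPr; rewrite ler_nM2r ?invr_lt0//; lra.
  rewrite ler_ndivrMr// [x * a]mulrC.
  (* A positive value at [y0] with [a < 0] puts [y0] strictly between the roots, so [y0 <= x]
     discards the left branch of the solutions and keeps the right one, which starts at
     [(b - s) / a]. *)
  have hy0 : -s < a * y0 - b < s.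
    by rewrite -ltr_norml ltr_norm_sqr// s2 -subr_lt0 -qE nmulr_rlt0.
  have -> : (y0 <= x) = (a * x <= a * y0) by rewrite ler_nM2l.
  split=> [[h1 h2]|h].
    have : s <= `|a * x - b|.
      by rewrite leNgt ltr_norm_sqr// s2 -leNgt -subr_ge0 -qE nmulr_rge0.
    by rewrite ler_normr => /orP[]; lra.
  split; first by lra.
  rewrite -(nmulr_rge0 _ an) qE subr_ge0 -s2 leNgt -ltr_norm_sqr// -leNgt.
  by rewrite ler_normr; apply/orP; right; lra.
have -> : (a < 0) = false by rewrite ltNge ltW.
rewrite ap /= ler_pdivlMr//.
have -> : (a * ((1 - rho ^+ 2) * beta ^+ 2) <= (sigma * M - rho * beta * mu) ^+ 2)
    = (0 <= D) by rewrite D4 pmulr_rge0// subr_ge0.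
(* If [D < 0], then [(a * x - b) ^+ 2 - D] is positive and the quadratic inequality fails for every
   [x]. *)
have [D0|D0] := leP 0 D; last first.
  split=> // -[_]; rewrite leNgt => /negP; case.
  by rewrite -(pmulr_rgt0 _ ap) qE subr_gt0 (lt_le_trans D0)// sqr_ge0.
have s2 : s ^+ 2 = D by rewrite sqr_sqrtr.
have hy0 : s < `|a * y0 - b|.
  by rewrite ltNge ler_norm_sqr// s2 -ltNge -subr_gt0 -qE pmulr_rgt0.
have -> : (y0 <= x) = (a * y0 <= a * x) by rewrite ler_pM2l.
have qle : (a * x ^+ 2 - 2 * b * x + c <= 0) = (-s <= a * x - b <= s).
  rewrite -(pmulr_rle0 _ ap) qE subr_le0 -s2 -ler_norm_sqr//.
  by rewrite ler_norml.
(* By [hy0] the point [y0] lies outside the segment between the roots. If it is left of the vertex,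
   the whole segment survives; otherwise it is right of both roots and nothing does. *)
have cE : (rho * beta * mu < sigma * M) = (a * y0 - b < 0).
  rewrite -(pmulr_rlt0 _ mu0) mulrBr mulrCA.
  have -> : mu * y0 = - M by rewrite -[LHS](addKr M) [mu * _]mulrC y0E addr0.
  rewrite mulrN -opprD oppr_lt0 [mu * b]mulrC aE -mulrA !pmulr_rgt0//.
  by rewrite subr_gt0.
rewrite qle /= cE; case: ltP => hc /=.
  have {}hy0 : a * y0 - b < - s by move: hy0; rewrite ltr0_norm//; lra.
  rewrite in_itv/= /f2 /f1 fpE fmE.
  have le_fmp : (b - s) / a <= (b + s) / a by rewrite ler_pM2r ?invr_gt0//; lra.
  rewrite (min_idPr le_fmp) (max_idPl le_fmp).
  rewrite ler_pdivrMr// ler_pdivlMr// [x * a]mulrC.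
  split=> [[_ /andP[h1 h2]]|/andP[h1 h2]]; first by apply/andP; split; lra.
  by split; [lra | apply/andP; split; lra].
split=> // -[h1 /andP[h2 h3]].
by move: hy0; rewrite ger0_norm//; lra.
Qed.

(** * Normal laws *)

Lemma measurable_EFin_normal_pdf (R : realType) (m s : R) (D : set (measurableTypeR R)) :
  measurable_fun D (EFin \o (normal_pdf m s : measurableTypeR R -> R)).
Proof.
by apply: measurable_funTS; apply/measurable_EFinP; exact: measurable_normal_pdf.
Qed.

Definition affine (R : realType) (m s : R) : measurableTypeR R -> measurableTypeR R :=
  fun y : R => m + s * y.

Lemma measurable_affine (R : realType) (m s : R) :
  measurable_fun [set: measurableTypeR R] (affine m s).
Proof. by apply: measurable_realfun.measurable_funD => //; exact: measurable_funM. Qed.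

HB.instance Definition _ (R : realType) (m s : R) :=
  isMeasurableFun.Build _ _ _ _ (affine m s) (measurable_affine m s).

(** The right-hand side is a measure in [A]; it suffices to compare it with Lebesgue measure on the
    intervals []a, b]]. *)
Lemma lebesgue_measure_affine (R : realType) (m s : R) (s0 : 0 < s)
    (A : set (measurableTypeR R)) : measurable A ->
  lebesgue_measure A = (s%:E * lebesgue_measure (affine m s @^-1` A))%E.
Proof.
move=> mA.
pose nu' := mscale (NngNum (ltW s0)) (pushforward lebesgue_measure (affine m s))
  : {measure set (measurableTypeR R) -> \bar R}.
pose nu := nu' (@measurable_affine R m s).
rewrite [LHS](@lebesgue_measure_unique _ nu)// => _ [[a b] _ <-].
rewrite /nu /= /mscale /= /pushforward /=.
have -> : affine m s @^-1` `]a, b] = `](a - m) / s, (b - m) / s]%classic.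
  apply/seteqP; split=> y /=; rewrite /affine !in_itv/= ltr_pdivrMr// ler_pdivlMr//.
    by move=> /andP[h1 h2]; apply/andP; split; lra.
  by move=> /andP[h1 h2]; apply/andP; split; lra.
rewrite !lebesgue_measure_itv/= !lte_fin ltr_pM2r ?invr_gt0// ltrD2r.
case: ifPn => _; last by rewrite mule0.
rewrite -!EFinB -EFinM; congr EFin; field.
by rewrite gt_eqF.
Qed.

(** Substitution [x = m + s y]: Lebesgue measure is [s] times its image under [affine m s], and the
    factor [s] turns the density at [m + s y] into the standard one at [y]. *)
Lemma normal_prob_affine (R : realType) (m s : R) (B : set (measurableTypeR R)) :
  0 < s -> measurable B ->
  normal_prob m s B = normal_prob 0 1 (affine m s @^-1` B).
Proof.
move=> s0 mB; rewrite /normal_prob.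
pose nu' := mscale (NngNum (ltW s0)) (pushforward lebesgue_measure (affine m s))
  : {measure set (measurableTypeR R) -> \bar R}.
pose nu := nu' (@measurable_affine R m s).
rewrite (@eq_measure_integral _ _ _ _ nu)/=; last first.
  by move=> A mA _; rewrite [LHS](lebesgue_measure_affine m s0).
rewrite ge0_integral_mscale//=; last 2 first.
- exact: measurable_EFin_normal_pdf.
- by move=> x _; rewrite lee_fin normal_pdf_ge0.
rewrite ge0_integral_pushforward//=; last 2 first.
- exact: measurable_EFin_normal_pdf.
- by move=> x _; rewrite lee_fin normal_pdf_ge0.
rewrite -ge0_integralZl//=; last 4 first.
- by rewrite -[X in measurable X]setTI; exact: measurable_affine.
- apply: measurable_funTS.
  exact: (measurableT_comp (measurable_EFin_normal_pdf m s (D := setT))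
    (@measurable_affine R m s)).
- by move=> x _; rewrite lee_fin normal_pdf_ge0.
- by rewrite lee_fin ltW.
apply: eq_integral => x _; rewrite -EFinM; congr EFin.
rewrite !normal_pdfE ?oner_eq0 ?gt_eqF//.
rewrite /normal_peak /normal_fun mulrA; congr (_ * expR _).
  rewrite expr1n mul1r -mulrnAr sqrtrM ?sqr_ge0// sqrtr_sqr ger0_norm ?ltW//.
  by rewrite invfM mulrA divff ?gt_eqF// mul1r.
by rewrite /affine; field; rewrite gt_eqF.
Qed.

Lemma normal_probN (R : realType) (B : set (measurableTypeR R)) : measurable B ->
  normal_prob 0 1 ((-%R : _ -> measurableTypeR R) @^-1` B) = normal_prob 0 1 B.
Proof.
move=> mB; rewrite /normal_prob.
pose nu := pushforward lebesgue_measure (-%R : measurableTypeR R -> measurableTypeR R).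
rewrite [RHS](@eq_measure_integral _ _ _ _ nu)/=; last first.
  by move=> A mA _; rewrite [RHS]lebesgue_measureN.
rewrite ge0_integral_pushforward//=; last 2 first.
- exact: measurable_EFin_normal_pdf.
- by move=> x _; rewrite lee_fin normal_pdf_ge0.
apply: eq_integral => x _; congr EFin.
by rewrite !normal_pdfE ?oner_eq0// /normal_fun !subr0 sqrrN.
Qed.

(** * The standard normal distribution function and its inverse *)

Lemma PhiE (R : realType) (x : R) : (Phi x)%:E = normal_prob 0 1 `]-oo, x].
Proof. by rewrite fineK// fin_num_measure. Qed.

Lemma is_derive_Phi (R : realType) (x : R) :
  is_derive x 1 (@Phi R) (normal_pdf 0 1 x).
Proof.
have := @continuous_FTC1 R (normal_pdf 0 1) -oo%O x (x + 1).
rewrite ltrDl ltr01 => /(_ isT) [|||H1 H2].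
- by apply: integrableS (integrable_normal_pdf 0 1).
- exact: ltNyr.
- exact/continuous_normal_pdf/oner_neq0.
by apply: DeriveDef => //; rewrite -derive1E.
Qed.

Lemma normal_pdf_gt0 (R : realType) (m s x : R) : s != 0 -> 0 < normal_pdf m s x.
Proof.
by move=> s0; rewrite normal_pdfE// mulr_gt0 ?expR_gt0 ?normal_peak_gt0.
Qed.

Lemma continuous_Phi (R : realType) : continuous (@Phi R).
Proof.
move=> x; apply: differentiable_continuous; apply/derivable1_diffP.
by have := is_derive_Phi x => -[].
Qed.

Lemma Phi_lt (R : realType) : {homo @Phi R : x y / x < y}.
Proof.
move=> x y xy; apply: (@gtr0_derive1_lt_cc _ _ x y) => //.
- by move=> z _; have := is_derive_Phi z => -[].
- move=> z _; rewrite derive1E (@derive_val _ _ _ _ _ _ _ (is_derive_Phi z)).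
  exact/normal_pdf_gt0/oner_neq0.
- exact/continuous_subspaceT/continuous_Phi.
- by rewrite in_itv/= lexx ltW.
- by rewrite in_itv/= lexx ltW.
Qed.

Lemma ltr_Phi (R : realType) : {mono @Phi R : x y / x < y}.
Proof. exact/leW_mono/le_mono/Phi_lt. Qed.

(** The identity as a real random variable: under the standard normal law its [cdf] is [Phi], which
    thereby inherits the limits at both infinities. *)
Definition Borel_id (R : realType) : measurableTypeR R -> R := idfun.

HB.instance Definition _ (R : realType) :=
  @isMeasurableFun.Build _ _ _ _ (@Borel_id R) (@measurable_id _ _ setT).

Lemma cvg_Phiy (R : realType) : @Phi R x @[x --> +oo] --> (1 : R).
Proof.
have := cvg_cdfy1 (@Borel_id R : {RV (normal_prob (0 : R) 1) >-> R}).
by move=> /fine_cvg; exact: cvg_trans.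
Qed.

Lemma cvg_PhiNy (R : realType) : @Phi R x @[x --> -oo] --> (0 : R).
Proof.
have := cvg_cdfNy0 (@Borel_id R : {RV (normal_prob (0 : R) 1) >-> R}).
by move=> /fine_cvg; exact: cvg_trans.
Qed.

(** Reflection maps []-oo, - x]] to [[x, +oo[], which differs from the complement of []-oo, x]] only
    by the point [x], of mass zero. *)
Lemma PhiN (R : realType) (x : R) : Phi (- x) = 1 - Phi x.
Proof.
apply: EFin_inj; rewrite EFinB !PhiE.
rewrite -(@probability_setC _ _ _ (normal_prob 0 1))//.
rewrite setCitvl -normal_probN//.
have -> : -%R @^-1` `]-oo, - x] = `[x, +oo[%classic :> set R.
  by apply/seteqP; split => y /=; rewrite !in_itv/= lerN2 andbT.
rewrite /normal_prob.
by rewrite -integral_itv_obnd_cbnd//; exact: measurable_EFin_normal_pdf.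
Qed.

(** [Phi_inv] picks a preimage whenever there is one, so only surjectivity onto []0, 1[] is at
    stake: the limits of [Phi] bracket [y], and the intermediate value theorem gives a preimage. *)
Lemma Phi_invK (R : realType) (y : R) : 0 < y < 1 -> Phi (Phi_inv y) = y.
Proof.
move=> /andP[y0 y1]; apply: pinvK; rewrite inE.
have [b [_ yb]] : exists b, 0 <= b /\ y <= Phi b.
  near (pinfty_nbhs R) => b; exists b; split.
    by near: b; apply: nbhs_pinfty_ge; rewrite ?num_real.
  near: b; apply: (cvgr_ge 1 (@cvg_Phiy R)) => //.
have [a [ab ya]] : exists a, a <= b /\ Phi a <= y.
  near (ninfty_nbhs R) => a; exists a; split.
    by near: a; apply: nbhs_ninfty_le; rewrite ?num_real.
  near: a; apply: (cvgr_le 0 (@cvg_PhiNy R)) => //.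
have [||c _ <-] := @IVT _ (@Phi R) a b y ab.
- exact/continuous_subspaceT/continuous_Phi.
- by rewrite ge_min ya le_max yb orbT.
by exists c.
Unshelve. all: by end_near. Qed.

(** * Moments of the standard normal law *)

(** The Radon-Nikodym derivative of the normal law has the same integrals as [normal_pdf], hence
    equals it almost everywhere and can be replaced by it in the change of measure. *)
Lemma ge0_integral_normal_prob (R : realType) (m s : R)
    (f : measurableTypeR R -> \bar R) :
  measurable_fun setT f -> (forall x, 0 <= f x)%E ->
  (\int[normal_prob m s]_x f x =
   \int[lebesgue_measure]_x (f x * (normal_pdf m s x)%:E))%E.
Proof.
move=> mf f0; have dom := @normal_prob_dominates R m s.
rewrite -(Radon_Nikodym_SigmaFinite.change_of_variables dom)//.
have mg : measurable_fun setT
    (Radon_Nikodym_SigmaFinite.f (normal_prob m s) (@lebesgue_measure R)).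
  apply: (measurable_int (@lebesgue_measure R)).
  exact: Radon_Nikodym_SigmaFinite.f_integrable.
apply: ae_eq_integral => //.
- exact: emeasurable_funM.
- by apply: emeasurable_funM => //; exact: measurable_EFin_normal_pdf.
apply: ae_eqe_mul2l => /=; apply: integral_ae_eq => //.
- exact: Radon_Nikodym_SigmaFinite.f_integrable.
- exact: measurable_EFin_normal_pdf.
by move=> E _ mE; rewrite -Radon_Nikodym_SigmaFinite.f_integral.
Qed.

Lemma normal_pdf01E (R : realType) (x : R) :
  normal_pdf 0 1 x = normal_peak 1 * expR (- (x ^+ 2 / 2)).
Proof.
rewrite normal_pdfE ?oner_eq0// /normal_fun subr0 mulNr; congr (_ * expR (- (_ / _))).
by rewrite expr1n.
Qed.

Lemma is_derive_normal_pdf01 (R : realType) (x : R) :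
  is_derive x 1 (@normal_pdf R 0 1) (- x * normal_pdf 0 1 x).
Proof.
have -> : @normal_pdf R 0 1 = (fun x => normal_peak 1 * expR (- (x ^+ 2 / 2))).
  by apply/funext => y; rewrite normal_pdf01E.
apply: is_derive_eq.
by rewrite /GRing.scale/=; field.
Qed.

(** This removes the boundary term at infinity in the integration by parts for the second moment.
    The bound [2 * normal_peak 1 / x] comes from [1 + u <= expR u] at [u = x ^+ 2 / 2]. *)
Lemma cvg_id_normal_pdf01 (R : realType) :
  x * @normal_pdf R 0 1 x @[x --> +oo] --> (0 : R).
Proof.
apply: (@squeeze_cvgr _ _ _ _ (fun=> 0)
  (fun x => (2 * normal_peak 1) * x^-1)); last 2 first.
- exact: cvg_cst.
- rewrite -[X in _ --> X](mulr0 (2 * normal_peak 1)).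
  apply: cvgMr; apply/gtr0_cvgV0; last exact: cvg_id.
  by apply: nbhs_pinfty_gt; rewrite num_real.
near=> x.
have x0 : 0 < x by near: x; apply: nbhs_pinfty_gt; rewrite num_real.
rewrite normal_pdf01E; apply/andP; split.
  by rewrite !mulr_ge0 ?normal_peak_ge0 ?expR_ge0 ?ltW.
rewrite mulrCA [2 * _]mulrC -[leRHS]mulrA ler_wpM2l ?normal_peak_ge0//.
rewrite expRN ler_pdivrMr ?expR_gt0//.
have := expR_ge1Dx (x ^+ 2 / 2).
have -> : 1 + x ^+ 2 / 2 = 1 + x / 2 * x by field.
move=> h; rewrite -ler_pdivrMl ?mulr_gt0 ?invr_gt0// invfM invrK.
by apply: le_trans h; lra.
Unshelve. all: by end_near. Qed.

Lemma integral_sqr_normal01 (R : realType) :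
  (\int[normal_prob (0:R) 1]_x (x ^+ 2)%:E = 1)%E.
Proof.
rewrite (@ge0_integral_normal_prob R 0 1 (fun x => (x ^+ 2)%:E)); last 2 first.
- by apply/measurable_EFinP; exact: measurable_funX.
- by move=> x; rewrite lee_fin sqr_ge0.
under eq_integral do rewrite -EFinM.
have cf : continuous (fun x : R => x ^+ 2 * normal_pdf 0 1 x).
  move=> x; apply: cvgM; first exact: sqr_continuous.
  exact/continuous_normal_pdf/oner_neq0.
rewrite (@ge0_symfun_integralT R (fun x => x ^+ 2 * normal_pdf 0 1 x))//; last 2 first.
- by move=> x; rewrite mulr_ge0 ?sqr_ge0 ?normal_pdf_ge0.
- by move=> x /=; rewrite !normal_pdf01E sqrrN.
have -> : [set x : R | 0 <= x] = `[0, +oo[%classic.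
  by apply/seteqP; split => x /=; rewrite in_itv/= andbT.
(* By parts: [(Phi x - x phi x)' = x^2 phi x] because [phi' x = - x phi x]. *)
pose F (x : R) := Phi x - x * normal_pdf 0 1 x.
have dF (x : R) : is_derive x 1 F (x ^+ 2 * normal_pdf 0 1 x).
  have h1 := is_derive_Phi x. have h2 := is_derive_normal_pdf01 x.
  rewrite /F; apply: is_derive_eq.
  rewrite /GRing.scale/=; ring.
rewrite (@ge0_continuous_FTC2y R _ F 0 1).
(* The half-line contributes [1 - Phi 0], and [Phi 0 = 1 / 2] by symmetry. *)
- rewrite /F mul0r subr0 -EFinB -EFinM; congr EFin.
  by have := @PhiN R 0; rewrite oppr0; lra.
- by move=> x _; rewrite mulr_ge0 ?sqr_ge0 ?normal_pdf_ge0.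
- exact: continuous_subspaceT.
- rewrite -[X in _ --> X]subr0; apply: cvgB; first exact: cvg_Phiy.
  exact: cvg_id_normal_pdf01.
- by move=> x _; have [] := dF x.
- apply: cvg_at_right_filter; apply: differentiable_continuous; apply/derivable1_diffP.
  by have [] := dF 0.
- by move=> x _; rewrite derive1E; have /@derive_val -> := dF x.
Qed.

(** * Transfer of moments between random variables of equal law *)

Lemma Lfun2P d (T : measurableType d) (R : realType)
    (P : {measure set T -> \bar R}) (X : T -> R) :
  measurable_fun setT X -> (\int[P]_x (X x ^+ 2)%:E < +oo)%E ->
  X \in Lfun P 2%:E.
Proof.
move=> mX h; rewrite inE; apply/andP; split; first by rewrite inE.
rewrite !inE/= /finite_norm unlock/= poweR_lty//.
move: h; congr (_ < _)%E; apply: eq_integral => x _.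
by rewrite /= powR_mulrn// real_normK// num_real.
Qed.

Section equal_laws.
Context d (T : measurableType d) d' (T' : measurableType d') (R : realType).
Variables (P : probability T R) (Q : probability T' R).
Variables (X : {RV P >-> R}) (Y : {RV Q >-> R}).
Hypothesis XY : forall B : set R, measurable B -> P (X @^-1` B) = Q (Y @^-1` B).

Lemma ge0_integral_equal_laws (g : R -> \bar R) :
  measurable_fun setT g -> (forall x, 0 <= g x)%E ->
  (\int[P]_x g (X x) = \int[Q]_x g (Y x))%E.
Proof.
move=> mg g0.
rewrite -[LHS](@ge0_integral_distribution _ _ _ _ _ P X g)//.
rewrite -[RHS](@ge0_integral_distribution _ _ _ _ _ Q Y g)//.
by apply: eq_measure_integral => A mA _; exact: XY.
Qed.

Lemma expectation_equal_laws : (X : T -> R) \in Lfun P 1 ->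
  (Y : T' -> R) \in Lfun Q 1 -> ('E_P[X] = 'E_Q[Y])%E.
Proof.
move=> /Lfun1_integrable iX /Lfun1_integrable iY; rewrite unlock.
rewrite -[LHS](@integral_distribution _ _ _ _ _ P X EFin)//.
rewrite -[RHS](@integral_distribution _ _ _ _ _ Q Y EFin)//.
by apply: eq_measure_integral => A mA _; exact: XY.
Qed.

Lemma Lfun2_equal_laws : (Y : T' -> R) \in Lfun Q 2%:E -> (X : T -> R) \in Lfun P 2%:E.
Proof.
move=> Y2; apply: Lfun2P => //.
rewrite (@ge0_integral_equal_laws (fun x => (x ^+ 2)%:E)).
- have /Lfun2_integrable_sqr/integrableP[_] := Y2.
  congr (_ < _)%E; apply: eq_integral => x _.
  by rewrite /= ger0_norm ?sqr_ge0.
- by apply/measurable_EFinP; exact: measurable_funX.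
- by move=> x; rewrite lee_fin sqr_ge0.
Qed.

Lemma variance_equal_laws : (Y : T' -> R) \in Lfun Q 2%:E -> ('V_P[X] = 'V_Q[Y])%E.
Proof.
move=> Y2; have X2 := Lfun2_equal_laws Y2.
have E : ('E_P[X] = 'E_Q[Y])%E.
  by apply: expectation_equal_laws; apply: Lfun_subset12 => //; rewrite fin_num_measure.
(* Both means are the same number [c], so the two variances are integrals of one non-negative
   function of the variable. *)
rewrite /variance covariance.unlock -E; set c := fine _; rewrite unlock.
apply: (@ge0_integral_equal_laws (fun x => ((x - c) * (x - c))%:E)).
- by apply/measurable_EFinP; apply: measurable_funM; exact: measurable_funB.
- by move=> x; rewrite lee_fin -expr2 sqr_ge0.
Qed.

End equal_laws.

(* [affine m s] with target [R], whose measurable structure has another display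
   than [measurableTypeR R]. *)
Definition affineR (R : realType) (m s : R) : measurableTypeR R -> R :=
  affine m s.

HB.instance Definition _ (R : realType) (m s : R) :=
  @isMeasurableFun.Build _ _ _ _ (@affineR R m s) (@measurable_affine R m s).

Section standard_normal_moments.
Variable R : realType.
Let N : probability (measurableTypeR R) R := normal_prob 0 1.

Lemma Lfun2_normal01 : (@Borel_id R : measurableTypeR R -> R) \in Lfun N 2%:E.
Proof.
by apply: Lfun2P => //; rewrite /N/= integral_sqr_normal01 ltry.
Qed.

Lemma affineRE (m s : R) : affineR m s = (cst m \+ s \o* @Borel_id R)%R.
Proof. by apply/funext => y; rewrite /affineR /affine /= mulrC. Qed.

Lemma Lfun2_affineR (m s : R) : (affineR m s : measurableTypeR R -> R) \in Lfun N 2%:E.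
Proof.
rewrite affineRE rpredD ?lee1n//= => _; first exact: Lfun_cst.
by apply: Lfun_scale; [rewrite ler1n|exact: Lfun2_normal01].
Qed.

Lemma expectation_affineR (m s : R) :
  ('E_N[affineR m s] = m%:E + s%:E * 'E_N[@Borel_id R])%E.
Proof.
rewrite affineRE expectationD ?expectation_cst ?expectationZl//.
- by apply: Lfun_subset12; [exact: fin_num_measure|exact: Lfun2_normal01].
- exact: Lfun_cst.
- apply: Lfun_subset12; first exact: fin_num_measure.
  by apply: Lfun_scale; [rewrite ler1n|exact: Lfun2_normal01].
Qed.

(** By symmetry the variable and its negative have equal laws, so the finite mean equals its own
    opposite. *)
Lemma expectation_normal01 : ('E_N[@Borel_id R] = 0)%E.
Proof.
have Z1 : (@Borel_id R : measurableTypeR R -> R) \in Lfun N 1.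
  by apply: Lfun_subset12; [exact: fin_num_measure|exact: Lfun2_normal01].
have : ('E_N[@Borel_id R] = 'E_N[affineR 0 (-1)])%E.
  apply: (@expectation_equal_laws _ _ _ _ _ N N (@Borel_id R) (affineR 0 (-1))) => //.
    move=> B mB; rewrite /N /= -normal_probN//; congr normal_prob.
    by apply/seteqP; split => y /=; rewrite /affineR /affine add0r mulN1r.
  by apply: Lfun_subset12; [exact: fin_num_measure|exact: Lfun2_affineR].
rewrite expectation_affineR add0e.
have := expectation_fin_num Z1.
case: ('E_N[_])%E => // r _; rewrite -EFinM => -[h]; congr EFin; lra.
Qed.

Lemma variance_normal01 : ('V_N[@Borel_id R] = 1)%E.
Proof.
rewrite varianceE; last exact: Lfun2_normal01.
rewrite expectation_normal01 expe2 mule0 sube0 unlock.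
exact: integral_sqr_normal01.
Qed.

Lemma variance_affineR (m s : R) : ('V_N[affineR m s] = (s ^+ 2)%:E)%E.
Proof.
rewrite affineRE varianceD_cst_l; last first.
  by apply: Lfun_scale; [rewrite ler1n|exact: Lfun2_normal01].
by rewrite varianceZ ?variance_normal01 ?mule1//; exact: Lfun2_normal01.
Qed.

End standard_normal_moments.

(** * Moments of Gaussian variables and laws of linear combinations *)

(** For [s = 0] the affine map is constant and yields the Dirac mass, so degenerate and proper
    Gaussian laws alike are images of the standard one and their moments need no case
    distinction. *)
Lemma gaussian_law_affine (R : realType) (m s : R) (B : set R) : 0 <= s ->
  measurable B -> gaussian_law m s B = normal_prob 0 1 (affineR m s @^-1` B).
Proof.
rewrite /gaussian_law le_eqVlt => /predU1P[<-|s0] mB; last first.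
  rewrite gt_eqF//; exact: (normal_prob_affine m s0 mB).
rewrite eqxx diracE.
have [mB'|mB'] := boolP (m \in B).
  rewrite (_ : _ @^-1` B = setT).
    by rewrite (@probability_setT _ _ _ (normal_prob 0 1)).
  apply/seteqP; split=> // y _ /=; rewrite /affineR /affine mul0r addr0.
  exact: set_mem.
rewrite (_ : _ @^-1` B = set0); first by rewrite measure0.
apply/seteqP; split=> // y /=; rewrite /affineR /affine mul0r addr0 => /mem_set.
by rewrite (negbTE mB').
Qed.

Section gaussian_moments.
Context d (T : measurableType d) (R : realType) (P : probability T R).
Variables (X : {RV P >-> R}) (m s : R).
Hypotheses (s0 : 0 <= s) (Xlaw : has_law P X (gaussian_law m s)).

Let law B : measurable B -> P (X @^-1` B) = normal_prob 0 1 (affineR m s @^-1` B).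
Proof. by move=> mB; rewrite Xlaw// gaussian_law_affine. Qed.

Lemma Lfun2_gaussian : (X : T -> R) \in Lfun P 2%:E.
Proof. exact: (Lfun2_equal_laws (Q := normal_prob 0 1) law (Lfun2_affineR m s)). Qed.

Lemma expectation_gaussian : ('E_P[X] = m%:E)%E.
Proof.
rewrite (@expectation_equal_laws _ _ _ _ _ P (normal_prob 0 1) X (affineR m s))//.
- by rewrite expectation_affineR expectation_normal01 mule0 adde0.
- by apply: Lfun_subset12; [exact: fin_num_measure|exact: Lfun2_gaussian].
- by apply: Lfun_subset12; [exact: fin_num_measure|exact: Lfun2_affineR].
Qed.

Lemma variance_gaussian : ('V_P[X] = (s ^+ 2)%:E)%E.
Proof.
rewrite (@variance_equal_laws _ _ _ _ _ P (normal_prob 0 1) X (affineR m s))//.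
  exact: variance_affineR.
exact: Lfun2_affineR.
Qed.

End gaussian_moments.

Section gaussian_vector_combination.
Context d (T : measurableType d) (R : realType) (P : probability T R).
Variables (U V : {RV P >-> R}) (t rho a b : R).
Hypotheses (t0 : 0 < t)
  (Ulaw : has_law P U (normal_prob 0 (Num.sqrt t)))
  (Vlaw : has_law P V (normal_prob 0 (Num.sqrt t)))
  (UVgauss : gaussian_vector P U V)
  (UVcov : covariance P U V = (rho * t)%:E).
Let v := t * (a ^+ 2 + 2 * rho * a * b + b ^+ 2).

(** [gaussian_vector] supplies a Gaussian law with unknown parameters [m] and [s]. Bilinearity of
    the covariance gives the combination mean [0] and variance [v], which identifies them; [0 < v]
    excludes the Dirac case. *)
Lemma gaussian_combination_law : 0 < v ->
  has_law P (fun w => a * U w + b * V w) (normal_prob 0 (Num.sqrt v)).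
Proof.
move=> v0; have [m [s [s0 L]]] := UVgauss a b.
have st0 : Num.sqrt t != 0 by rewrite gt_eqF// sqrtr_gt0.
have Ug : has_law P U (gaussian_law 0 (Num.sqrt t)).
  by move=> B mB; rewrite /gaussian_law (negbTE st0) Ulaw.
have Vg : has_law P V (gaussian_law 0 (Num.sqrt t)).
  by move=> B mB; rewrite /gaussian_law (negbTE st0) Vlaw.
have U2 := Lfun2_gaussian (sqrtr_ge0 t) Ug.
have V2 := Lfun2_gaussian (sqrtr_ge0 t) Vg.
have Pfin : P setT \is a fin_num by exact: fin_num_measure.
have U1 := Lfun_subset12 Pfin U2.
have V1 := Lfun_subset12 Pfin V2.
have EU := expectation_gaussian (sqrtr_ge0 t) Ug.
have EV := expectation_gaussian (sqrtr_ge0 t) Vg.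
have VU := variance_gaussian (sqrtr_ge0 t) Ug.
have VV := variance_gaussian (sqrtr_ge0 t) Vg.
have mW : measurable_fun setT (fun w => a * U w + b * V w).
  by apply: measurable_funD; exact: measurable_funM.
pose W : {RV P >-> R} := HB.pack (fun w => a * U w + b * V w)
  (isMeasurableFun.Build _ _ _ _ _ mW).
have WE : (W : T -> R) = ((a \o* U) \+ (b \o* V))%R.
  by apply/funext => w; rewrite /= ![_ * a]mulrC ![_ * b]mulrC.
have aU2 : (a \o* U)%R \in Lfun P 2%:E by apply: Lfun_scale; rewrite ?ler1n.
have bV2 : (b \o* V)%R \in Lfun P 2%:E by apply: Lfun_scale; rewrite ?ler1n.
have aU1 := Lfun_subset12 Pfin aU2.
have bV1 := Lfun_subset12 Pfin bV2.
have EW : ('E_P[a \o* U \+ b \o* V] = 0)%E.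
  rewrite (expectationD aU1 bV1) (expectationZl a U1) (expectationZl b V1).
  by rewrite EU EV !mule0 adde0.
have UV1 : ((U : T -> R) * (V : T -> R) : T -> R)%R \in Lfun P 1.
  exact: Lfun2_mul_Lfun1.
have UbV1 : ((U : T -> R) * (b \o* V) : T -> R)%R \in Lfun P 1 by exact: Lfun2_mul_Lfun1.
have VW : ('V_P[(a \o* U \+ b \o* V)%R] = v%:E)%E.
  rewrite (varianceD aU2 bV2) (varianceZ a U2) (varianceZ b V2) VU VV.
  rewrite (covarianceZl a U1 bV1 UbV1) (covarianceZr b U1 V1 UV1) UVcov.
  rewrite sqr_sqrtr ?ltW// -!EFinM -!EFinD; congr EFin.
  by rewrite /v; ring.
have LW : has_law P W (gaussian_law m s) := L.
have m0 : m = 0.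
  by apply: EFin_inj; rewrite -(expectation_gaussian s0 LW) WE EW.
have s2 : s ^+ 2 = v.
  by apply: EFin_inj; rewrite -(variance_gaussian s0 LW) WE VW.
have sv : s = Num.sqrt v.
  by rewrite -s2 sqrtr_sqr ger0_norm.
move=> B mB; rewrite L// m0 /gaussian_law sv gt_eqF// sqrtr_gt0//.
Qed.

End gaussian_vector_combination.

(** * Conditioning on a sub-sigma-algebra *)

Section sub_sigma_algebra.
Context d (Omega : measurableType d) (R : realType) (P : probability Omega R).
Variable G : set (set Omega).
Hypotheses (hG : sigma_algebra setT G) (sG : G `<=` measurable).
Local Notation OmegaG := (g_sigma_algebraType G).

Lemma measurable_subE (A : set OmegaG) : measurable A = G A.
Proof. exact: (congr1 (fun C => C A) (measurable_g_measurableTypeE hG)). Qed.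

Lemma measurable_to_sub : measurable_fun setT (idfun : Omega -> OmegaG).
Proof. by move=> _ A; rewrite measurable_subE setTI preimage_id => /sG. Qed.

Lemma measurable_wrtP (g : Omega -> R) :
  measurable_wrt G g <-> measurable_fun setT (g : OmegaG -> R).
Proof.
split=> [h _ B mB|h B mB]; first by rewrite measurable_subE setTI; exact: h.
by rewrite -measurable_subE -[X in measurable X]setTI; exact: h.
Qed.

(** Uniqueness of conditional expectations. The usual uniqueness of integrands is applied on [Omega]
    equipped with [G] and the restriction of [P], which is the law of the identity [J]; a null set
    of [G] is also one of the full sigma-algebra. *)
Lemma ae_eq_sub_sigma (g1 g2 : OmegaG -> \bar R) :
  measurable_fun setT g1 -> measurable_fun setT g2 ->
  (forall w, 0 <= g1 w <= 1)%E -> (forall w, 0 <= g2 w)%E ->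
  (forall A, G A -> \int[P]_(w in A) g1 w = \int[P]_(w in A) g2 w)%E ->
  {ae P, forall w, g1 w = g2 w}.
Proof.
move=> m1 m2 g1b g2b E.
pose J : {RV P >-> OmegaG} := HB.pack (idfun : Omega -> OmegaG)
  (isMeasurableFun.Build _ _ _ _ _ measurable_to_sub).
have : ae_eq (distribution P J) setT g1 g2.
  apply: integral_ae_eq => //.
    apply: (@le_integrable _ _ _ (distribution P J) setT measurableT _
      (EFin \o cst 1)) => //.
      by move=> w _; have /andP[h0 h1] := g1b w; rewrite /= gee0_abs// normr1.
    exact: finite_measure_integrable_cst.
  move=> A _ mA; have GA : G A by rewrite -measurable_subE.
  have I g : measurable_fun setT g -> (forall w, 0 <= g w)%E ->
      (\int[distribution P J]_(w in A) g w = \int[P]_(w in A) g w)%E.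
    move=> mg g0; rewrite ge0_integral_pushforward//; exact: measurable_funTS.
  by rewrite !I// => [|w]; [exact: E|have /andP[] := g1b w].
move=> [N [mN N0 sub]].
exists N; split=> //; first by apply: sG; rewrite -measurable_subE.
by move=> w /= h; apply: sub => /= /(_ I).
Qed.

Context d' (U : measurableType d') (Z : {mfun Omega >-> U}).
Hypothesis indep : independent_of P G (Z : Omega -> U).

(* The identity is a random variable with values in [Omega] equipped with [G];
   it is independent of [Z], so its joint law with [Z] is a product measure. *)
Lemma freezing (C : set (OmegaG * U)) : measurable C ->
  P [set w | C (w, Z w)] = (\int[P]_w P (Z @^-1` xsection C w))%E.
Proof.
move=> mC.
pose J : {RV P >-> OmegaG} := HB.pack (idfun : Omega -> OmegaG)
  (isMeasurableFun.Build _ _ _ _ _ measurable_to_sub).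
have mJZ : measurable_fun setT (fun w : Omega => (J w, Z w)).
  exact: measurable_fun_pair.
pose JZ : {RV P >-> (OmegaG * U)%type} := HB.pack (fun w : Omega => (J w, Z w))
  (isMeasurableFun.Build _ _ _ _ _ mJZ).
transitivity (distribution P JZ C); first by [].
rewrite -(@product_measure_unique _ _ _ _ R (distribution P J) (distribution P Z))//.
  rewrite /product_measure1 ge0_integral_distribution//.
  exact: measurable_fun_xsection.
move=> A B mA mB; apply: indep => //; by rewrite -measurable_subE.
Qed.

(** Given [G], the first argument of [H] may be held fixed while the independent [Z] keeps its law.
    Both sides are [G]-measurable in [w], so equality of their integrals over each [A] in [G] is
    enough. *)
Lemma conditional_law_freezing (H : Omega -> U -> R) (Y : Omega -> R)
    (kappa : Omega -> probability (measurableTypeR R) R) (B : set R) :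
  measurable_fun setT (fun p : OmegaG * U => H p.1 p.2) ->
  (forall w, Y w = H w (Z w)) ->
  conditional_law P G Y kappa -> measurable B ->
  {ae P, forall w, kappa w B = P (Z @^-1` (H w @^-1` B))}.
Proof.
move=> mH YH [ck ci] mB.
pose C := [set p : OmegaG * U | B (H p.1 p.2)].
have mC : measurable C by rewrite -[X in measurable X]setTI; exact: mH.
have xC w : xsection C w = H w @^-1` B.
  by apply/seteqP; split=> z; rewrite /xsection /= ?inE// => /mem_set; rewrite inE.
apply: (@ae_eq_sub_sigma (fun w => kappa w B) (fun w => P (Z @^-1` (H w @^-1` B)))).
- have /measurable_wrtP/measurable_EFinP := ck B mB.
  by apply: eq_measurable_fun => w _; rewrite /= fineK// fin_num_measure.
- have := measurable_fun_xsection (distribution P Z) mC.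
  by apply: eq_measurable_fun => w _; rewrite /= xC.
- by move=> w; rewrite measure_ge0 probability_le1.
- by [].
move=> A GA; rewrite ci//.
(* Intersecting with [A] inside the product lets [freezing] handle the integral over [A]: the
   section of [C'] at [w] is that of [C] for [w] in [A] and empty otherwise. *)
pose C' := C `&` (A `*` setT).
have mC' : measurable C'.
  by apply: measurableI => //; apply: measurableX => //; rewrite measurable_subE.
transitivity (P [set w | C' (w, Z w)]).
  congr (P _); apply/seteqP; split=> w /=; rewrite /C' /C /= YH; tauto.
rewrite freezing// [RHS]integral_mkcond; apply: eq_integral => w _.
rewrite patchE; case: ifPn => wA.
  congr (P _); apply/seteqP; split=> z; rewrite /xsection /= ?inE.
    by case.
  by move=> h; split=> //; split=> //; exact: set_mem.
rewrite (_ : _ @^-1` _ = set0) ?measure0//.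
apply/seteqP; split=> z //; rewrite /xsection /= inE => -[_ [/mem_set]].
by rewrite (negbTE wA).
Qed.

End sub_sigma_algebra.

(** * Value-at-risk *)

Lemma ae_forall_countable d (T : measurableType d) (R : realType)
    (mu : {measure set T -> \bar R}) (I : countType) (Q : I -> T -> Prop) :
  (forall i, {ae mu, forall x, Q i x}) -> {ae mu, forall x, forall i, Q i x}.
Proof.
move=> h.
have : {ae mu, forall x, forall n,
    (fun n x => if unpickle n is Some i then Q i x else True) n x}.
  apply: ae_foralln => n; case: unpickle => [i|]; first exact: h.
  exact: aeW.
by apply: filterS => x hx i; have := hx (pickle i); rewrite pickleK.
Qed.

(** A set closed downwards is controlled by its rational elements. Thus countably many levels, hence
    a single null set, determine the conditional quantile. *)
Lemma sup_rational_cut (R : realType) (S : set R) (c : R) :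
  (forall x y, x <= y -> S y -> S x) ->
  (forall q : rat, S (ratr q) <-> ratr q < c) -> sup S = c.
Proof.
move=> Sdown Sq.
have ubS : ubound S c.
  move=> y Sy; rewrite leNgt; apply/negP => /rat_in_itvoo[q].
  rewrite in_itv/= => /andP[cq qy].
  by have /Sq := Sdown _ _ (ltW qy) Sy; rewrite ltNge ltW.
have inS x : x < c -> exists2 y, S y & x < y.
  move=> /rat_in_itvoo[q]; rewrite in_itv/= => /andP[xq qc].
  by exists (ratr q) => //; exact/Sq.
apply/eqP; rewrite eq_le; apply/andP; split.
  apply: ge_sup => //; have [|y Sy _] := inS (c - 1); first by rewrite gtrBl.
  by exists y.
rewrite leNgt; apply/negP => /inS[y Sy]; rewrite ltNge => /negP; apply.
by apply: ub_le_sup => //; exists c.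
Qed.

Lemma cond_quantile_gaussian (R : realType) (Omega : Type)
    (kappa : Omega -> probability (measurableTypeR R) R) (w : Omega)
    (m s p : R) : 0 < s -> 0 < p < 1 ->
  (forall q : rat, kappa w `]-oo, ratr q]%classic = (Phi ((ratr q - m) / s))%:E) ->
  cond_quantile kappa p w = m - s * Phi_inv (1 - p).
Proof.
move=> s0 /andP[p0 p1] h; apply: sup_rational_cut.
  move=> x y xy /=; apply: le_lt_trans; apply: le_measure; rewrite ?inE//.
  exact: subset_itvl.
move=> q; rewrite /= h lte_fin.
set z := Phi_inv (1 - p).
(* Strict monotonicity of [Phi] then reduces the condition on the level to
   [(ratr q - m) / s < - z]. *)
have -> : p = Phi (- z).
  by rewrite PhiN /z Phi_invK ?subKr// subr_gt0 p1 gtrBl p0.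
rewrite ltr_Phi ltr_pdivrMr//.
split; lra.
Qed.

(** As [0 <= c], the bound on the negative part is a bound on the negated quantile alone. *)
Lemma value_at_risk_gaussian_le (R : realType) (Omega : Type)
    (kappa : Omega -> probability (measurableTypeR R) R) (w : Omega)
    (m s p c : R) : 0 < s -> 0 < p < 1 -> 0 <= c ->
  (forall q : rat, kappa w `]-oo, ratr q]%classic = (Phi ((ratr q - m) / s))%:E) ->
  (value_at_risk kappa p w <= c) = (s * Phi_inv (1 - p) - m <= c).
Proof.
move=> s0 p01 c0 h; rewrite /value_at_risk (cond_quantile_gaussian s0 p01 h).
by rewrite /neg_part ge_max c0 opprB.
Qed.

Lemma adapted_increment_measurable d (Omega : measurableType d) (R : realType)
    (P : probability Omega R) (F : R -> set (set Omega)) (W : R -> Omega -> R)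
    (s t : R) : usual_filtration P F -> brownian_motion P F W -> 0 <= s -> s <= t ->
  measurable_fun setT (increment W s t).
Proof.
move=> hF hW s0 st; have t0 := le_trans s0 st.
have mW u : 0 <= u -> measurable_fun setT (W u).
  move=> u0 _ B mB; rewrite setTI; apply: (usual_sub hF u0).
  exact: (bm_adapted hW u0).
by apply: measurable_funB; exact: mW.
Qed.

(** * The conditional law of the wealth change and the constraint *)

Lemma wealth_change_cond_cdf (R : realType) (d : measure_display)
    (Omega : measurableType d) (P : probability Omega R)
    (F : R -> set (set Omega)) (W1 W2 X f : R -> Omega -> R)
    (mu sigma beta tau alpha rho t : R)
    (kappa : Omega -> probability (measurableTypeR R) R) :
  usual_filtration P F -> correlated_brownian_motions P F W1 W2 rho ->
  measurable_wrt (F t) (f t) -> 0 < beta -> 0 < tau -> rho ^+ 2 < 1 -> 0 <= t ->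
  conditional_law P (F t)
      (wealth_change mu sigma alpha beta W1 W2 X f t tau) kappa ->
  {ae P, forall w, forall q : rat, kappa w `]-oo, ratr q]%classic =
    (Phi ((ratr q - (f t w * mu + alpha) * tau) /
       Num.sqrt (tau * ((f t w * sigma) ^+ 2 +
         2 * rho * (f t w * sigma) * beta + beta ^+ 2))))%:E}.
Proof.
move=> hF hW hf b0 tau0 r1 t0 hk.
have ttau : t < t + tau by rewrite ltrDl.
have mU := adapted_increment_measurable hF (cbm_fst hW) t0 (ltW ttau).
have mV := adapted_increment_measurable hF (cbm_snd hW) t0 (ltW ttau).
pose U : {RV P >-> R} := HB.pack (increment W1 t (t + tau))
  (isMeasurableFun.Build _ _ _ _ _ mU).
pose V : {RV P >-> R} := HB.pack (increment W2 t (t + tau))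
  (isMeasurableFun.Build _ _ _ _ _ mV).
pose Z : {RV P >-> (R * R)%type} := HB.pack (fun w => (U w, V w))
  (isMeasurableFun.Build _ _ _ _ _ (measurable_fun_pair mU mV)).
have hG := usual_sigma hF t0; have sG := usual_sub hF t0.
have tauE : t + tau - t = tau by rewrite addrAC subrr add0r.
have Ulaw : has_law P U (normal_prob 0 (Num.sqrt tau)).
  by rewrite -tauE; exact: (bm_normal (cbm_fst hW) t0 ttau).
have Vlaw : has_law P V (normal_prob 0 (Num.sqrt tau)).
  by rewrite -tauE; exact: (bm_normal (cbm_snd hW) t0 ttau).
have UVcov : covariance P U V = (rho * tau)%:E.
  by rewrite -tauE; exact: (cbm_cov hW t0 ttau).
(* The wealth at time [t] cancels in the change; what depends on the past is the position [f t w],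
   and [z] stands for the pair of increments. *)
pose H (w : Omega) (z : R * R) :=
  (f t w * mu + alpha) * tau + (f t w * sigma * z.1 + beta * z.2).
have mH : measurable_fun setT
    (fun x : g_sigma_algebraType (F t) * (R * R) => H x.1 x.2).
  have mf : measurable_fun setT
      (fun x : g_sigma_algebraType (F t) * (R * R) => f t x.1).
    apply: (measurableT_comp (f := f t : g_sigma_algebraType (F t) -> R)).
      exact/measurable_wrtP.
    exact: measurable_fst.
  apply: measurable_funD; first by
    apply: measurable_funM => //; apply: measurable_funD => //; exact: measurable_funM.
  apply: measurable_funD; apply: measurable_funM => //.
  - exact: measurable_funM.
  - by apply: (measurableT_comp measurable_fst); exact: measurable_snd.
  - by apply: (measurableT_comp measurable_snd); exact: measurable_snd.
have hY w : wealth_change mu sigma alpha beta W1 W2 X f t tau w = H w (Z w).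
  by rewrite /wealth_change /frozen_wealth /H /= /increment; ring.
apply: ae_forall_countable => q.
have mB : measurable (`]-oo, ratr q]%classic : set R) by [].
have := @conditional_law_freezing _ _ _ P (F t) hG sG _ _ Z
  (cbm_indep hW t0 ttau) H _ kappa _ mH hY hk mB.
apply: filterS => w ->.
set a := f t w * sigma; set m := (f t w * mu + alpha) * tau.
set v := tau * (a ^+ 2 + 2 * rho * a * beta + beta ^+ 2).
(* The conditional variance stays positive for every position, even where [a + rho * beta = 0],
   thanks to [rho ^+ 2 < 1] and [0 < beta]. *)
have v0 : 0 < v.
  have -> : v = tau * ((a + rho * beta) ^+ 2 + (1 - rho ^+ 2) * beta ^+ 2).
    by rewrite /v; ring.
  by rewrite mulr_gt0// ltr_wpDl ?sqr_ge0// mulr_gt0 ?subr_gt0 ?exprn_gt0.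
have s0 : 0 < Num.sqrt v by rewrite sqrtr_gt0.
have L := gaussian_combination_law tau0 Ulaw Vlaw (cbm_gaussian hW t0 ttau) UVcov v0.
transitivity (P ((fun w' => a * U w' + beta * V w') @^-1` `]-oo, ratr q - m])).
  congr (P _); apply/seteqP; split=> w' /=; rewrite !in_itv/= /H /= -/m -/a; lra.
rewrite L// (normal_prob_affine 0 s0)// PhiE; congr normal_prob.
apply/seteqP; split=> y /=; rewrite /affine !in_itv/= ler_pdivlMr//; lra.
Qed.

(** Conditional laws are determined up to null sets, so the equivalence is almost sure for any
    version [kappa]. The level is non-negative because [value_at_risk] is: for a negative level the
    constraint would always fail, while the interval may be non-empty. *)
Theorem proposition2 (R : realType) (d : measure_display)
    (Omega : measurableType d) (P : probability Omega R)
    (F : R -> set (set Omega)) (W1 W2 X f : R -> Omega -> R)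
    (mu sigma beta tau p alpha rho VaRbar T N M : R)
    (hF : usual_filtration P F)
    (hW : correlated_brownian_motions P F W1 W2 rho)
    (hX : forall t : R, 0 <= t <= T -> measurable_wrt (F t) (X t))
    (hf : forall t : R, 0 <= t <= T -> measurable_wrt (F t) (f t))
    (hmu : 0 < mu) (hsigma : 0 < sigma) (hbeta : 0 < beta) (htau : 0 < tau)
    (hp : 0 < p < 1) (hrho : rho ^+ 2 < 1) (hVaRbar : 0 <= VaRbar)
    (hN : N = Phi_inv (1 - p) / Num.sqrt tau)
    (hM : M = alpha + VaRbar / tau)
    (hN0 : 0 < N) (hM0 : 0 < M) :
  forall t : R, 0 <= t <= T ->
  forall kappa : Omega -> probability (measurableTypeR R) R,
    conditional_law P (F t)
      (wealth_change mu sigma alpha beta W1 W2 X f t tau) kappa ->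
    {ae P, forall w,
      value_at_risk kappa p w <= VaRbar <->
      VaR_interval mu sigma beta rho N M (f t w)}.
Proof.
move=> t tT kappa hk; have /andP[t0 _] := tT.
have := wealth_change_cond_cdf hF hW (hf t tT) hbeta htau hrho t0 hk.
apply: filterS => w hw; set x := f t w in hw *.
rewrite -VaR_intervalP//.
set g := (X in N * Num.sqrt X).
have gE : (x * sigma) ^+ 2 + 2 * rho * (x * sigma) * beta + beta ^+ 2 = g.
  by rewrite /g; ring.
have g0 : 0 < g.
  have -> : g = (sigma * x + rho * beta) ^+ 2 + (1 - rho ^+ 2) * beta ^+ 2.
    by rewrite /g; ring.
  by rewrite ltr_wpDl ?sqr_ge0// mulr_gt0 ?subr_gt0 ?exprn_gt0.
rewrite gE in hw.
have s0 : 0 < Num.sqrt (tau * g) by rewrite sqrtr_gt0 mulr_gt0.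
rewrite (value_at_risk_gaussian_le s0 hp hVaRbar hw).
have tau2 : Num.sqrt tau * Num.sqrt tau = tau by rewrite -expr2 sqr_sqrtr// ltW.
have st0 : Num.sqrt tau != 0 by rewrite gt_eqF// sqrtr_gt0.
have zE : Phi_inv (1 - p) = N * Num.sqrt tau by rewrite hN divfK.
(* One [Num.sqrt tau] comes from the standard deviation and one from the quantile. With [VaRbar]
   written as [tau * (M - alpha)], the factor [tau] then cancels throughout. *)
have -> : Num.sqrt (tau * g) * Phi_inv (1 - p) = tau * (N * Num.sqrt g).
  by rewrite sqrtrM ?ltW// zE -[in RHS]tau2; ring.
have VE : VaRbar = tau * (M - alpha) by rewrite hM; field; rewrite gt_eqF.
rewrite VE lerBlDr.
have -> : tau * (M - alpha) + (x * mu + alpha) * tau = tau * (M + x * mu) by ring.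
by rewrite ler_pM2l.
Qed.
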